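(* Let $(E,C)$ be an adaptable separated graph. Then the semigroup $S(E,C)$ is an inverse semigroup.
   Context: **Adaptable separated graphs.** $\mathbb N=\{1,2,\dots\}$. For a directed graph $E=(E^0,E^1,s,r)$, paths are $e_1\cdots e_n$ with $r(e_i)=s(e_{i+1})$; vertices are paths of length $0$. A separated graph $(E,C)$ is a directed graph $E$ with $C=\bigsqcup_{v\in E^0}C_v$, where $C_v$ is a partition of $s^{-1}(v)$ into nonempty subsets ($C_v=\emptyset$ if $v$ is a sink). It is finitely separated if all sets in $C$ are finite. Put $v\le w$ if there is a path from $w$ to $v$; let $(I,\le)$ be the antisymmetrization of $(E^0,\le)$, whose elements are the transitive components. A finitely separated graph $(E,C)$ is adaptable if $I$ is finite and there are a partition $I=I_{free}\sqcup I_{reg}$ and subgraphs $(E_p)_{p\in I}$, with $E_p^0$ the vertex set of the component $p$, such that: (1) $E^0=\bigsqcup_p E_p^0$; $E_p$ is a transitive (any two vertices joined by a directed path) row-finite graph if $p\in I_{reg}$; $E_p^0=\{v^p\}$ if $p\in I_{free}$. (2) For $p\in I_{reg}$, $w\in E_p^0$: $|C_w|=1$, $|s_{E_p}^{-1}(w)|\ge 2$, and every edge with source $w$ lies in $E_p$ or has range in $E_q^0$ with $q<p$. (3) For $p\in I_{free}$: $s^{-1}(v^p)=\emptyset$ iff $p$ is minimal in $I$ (then put $k(p)=0$). If $p$ is not minimal, $C_{v^p}=\{X_1^{(p)},\dots,X_{k(p)}^{(p)}\}$ is finite with $X_i^{(p)}=\{\alpha(p,i),\beta(p,i,1),\dots,\beta(p,i,g(p,i))\}$,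 $g(p,i)\ge1$, $\alpha(p,i)$ a loop at $v^p$, $r(\beta(p,i,t))\in E_q^0$ with $q<p$; and $E_p^1=\{\alpha(p,1),\dots,\alpha(p,k(p))\}$. **The $*$-semigroup $S(E,C)$.** It is the $*$-semigroup with $0$ ($*$-semigroup: $s^{**}=s$, $(st)^*=t^*s^*$) generated by $E^0\cup E^1\cup\{(t_i^v)^{\pm1}: i\in\mathbb N,v\in E^0\}$ with relations: (R1) $vw=\delta_{v,w}v$, $v^*=v$ for $v,w\in E^0$; (R2) $e=s(e)e=er(e)$ for $e\in E^1$, and $e^*f=\delta_{e,f}r(e)$ for $e,f$ in the same set $X\in C$; (R3) for $p\in I_{free}$, $i\ne j$: $\alpha(p,i)\alpha(p,j)=\alpha(p,j)\alpha(p,i)$, $\alpha(p,i)\alpha(p,j)^*=\alpha(p,j)^*\alpha(p,i)$; (R4) for $p\in I_{free}$: $\beta(p,i,s)^*\beta(p,j,t)=0$ if $(i,s)\neq(j,t)$; (R5) for each $v$ the elements $(t_i^v)^{\pm1}$ commute mutually, $vt_i^v=t_i^v=t_i^vv$, $t_i^v(t_i^v)^{-1}=v=(t_i^v)^{-1}t_i^v$, $(t_i^v)^*=(t_i^v)^{-1}$; (R6) $t_i^{s(e)}e=e\,t_i^{r(e)}$ if $s(e)\in E_p^0$, $p\in I_{reg}$; (R7) for $p\in I_{free}$: $(t_i^{v^p})^{\pm1}\beta(p,j,s)=\beta(p,j,s)(t^{r(\beta(p,j,s))}_{i+k(p)-1})^{\pm1}$; (R8) for $p\in I_{free}$, $i\ne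 j$: $\alpha(p,i)\beta(p,j,s)=\beta(p,j,s)t^{r(\beta(p,j,s))}_{\sigma_j^p(i)}$ and $\alpha(p,i)^*\beta(p,j,s)=\beta(p,j,s)(t^{r(\beta(p,j,s))}_{\sigma_j^p(i)})^{-1}$, where $\sigma_j^p$ is the increasing bijection $\{1,\dots,k(p)\}\setminus\{j\}\to\{1,\dots,k(p)-1\}$; (R9) for $p\in I_{free}$: $t_i^{v^p}$ commutes with $\alpha(p,j)$ and $\alpha(p,j)^*$. An inverse semigroup is a semigroup in which for each $s$ there is a unique element $s^*$ with $s=ss^*s$ and $s^*=s^*ss^*$ (here the inverse is given by the $*$-operation of $S(E,C)$). *)

(* Defs.v *)
From HB Require Import structures.
From mathcomp Require Import all_boot.
From mathcomp Require Import boolp classical_sets functions cardinality.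

Set Implicit Arguments.
Unset Strict Implicit.
Unset Printing Implicit Defensive.

Local Open Scope classical_set_scope.
Local Open Scope quotient_scope.
Local Open Scope card_scope.
Local Open Scope group_scope.

HB.mixin Record Semigroup_isStar0Semigroup S of Semigroup S := {
  szero : S;
  star : S -> S;
  mul0s : forall s : S, szero * s = szero;
  muls0 : forall s : S, s * szero = szero;
  starK : forall s : S, star (star s) = s;
  starM : forall s t : S, star (s * t) = star t * star s
}.

#[short(type="star0SemigroupType")]
HB.structure Definition Star0Semigroup :=
  {S of Semigroup_isStar0Semigroup S & Semigroup S}.

Definition semigroup_inverse (S : semigroupType) (s t : S) : Prop :=
  s = s * t * s /\ t = t * s * t.

Definition inverse_semigroup (S : semigroupType) : Prop :=
  forall s : S, exists! t : S, semigroup_inverse s t.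

Record digraph := Digraph {
  vertex : Type;
  edge : Type;
  src : edge -> vertex;
  rng : edge -> vertex
}.

Arguments src {d}.
Arguments rng {d}.

(* [is_path D v p w]: the edges in p all lie in D and p is a directed path from
   v to w; for p empty this is the path of length 0 at v = w. *)
Fixpoint is_path (E : digraph) (D : set (edge E)) (v : vertex E)
    (p : seq (edge E)) (w : vertex E) : Prop :=
  if p is e :: p' then [/\ D e, src e = v & is_path D (rng e) p' w] else v = w.

(* v <= w : there is a path from w to v (note the direction) *)
Definition vle (E : digraph) (v w : vertex E) : Prop :=
  exists p, is_path setT w p v.

Definition class_of (E : digraph) (v : vertex E) : set (vertex E) :=
  [set w | vle v w /\ vle w v].

(* The antisymmetrization I of the preorder on vertices: its elements are the
   equivalence classes, as sets of vertices. *)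
Definition component (E : digraph) : Type := set_type (range (@class_of E)).

Definition cverts (E : digraph) (p : component E) : set (vertex E) := sval p.

Definition cle (E : digraph) (p q : component E) : Prop :=
  exists v w, [/\ cverts p v, cverts q w & vle v w].

Definition clt (E : digraph) (p q : component E) : Prop := cle p q /\ p <> q.

Definition cminimal (E : digraph) (p : component E) : Prop :=
  forall q, ~ clt q p.

Record separated_graph := SeparatedGraph {
  sgraph :> digraph;
  sep : vertex sgraph -> set (set (edge sgraph));
  sepP : forall v, partition (sep v) id (src @^-1` [set v])
}.

Definition finitely_separated (E : separated_graph) : Prop :=
  forall (v : vertex E) (X : set (edge E)), sep v X -> finite_set X.

Record subgraph (E : digraph) := Subgraph {
  sub_vert : set (vertex E);
  sub_edge : set (edge E);
  sub_closed : forall e, sub_edge e -> sub_vert (src e) /\ sub_vert (rng e)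
}.

Definition sub_out (E : digraph) (F : subgraph E) (v : vertex E) :
  set (edge E) := [set e | sub_edge F e /\ src e = v].

Definition sub_transitive (E : digraph) (F : subgraph E) : Prop :=
  forall v w, sub_vert F v -> sub_vert F w ->
    exists p, is_path (sub_edge F) v p w.

Definition sub_row_finite (E : digraph) (F : subgraph E) : Prop :=
  forall v, sub_vert F v -> finite_set (sub_out F v).

(* The indices i, t of alpha(p,i), beta(p,i,t) start at 0 instead of 1. The
   fields vtx, nsets, nbeta, alpha, beta (v^p, k(p), g(p,i), ...) are only
   meaningful, and only constrained and used, at free components. *)
Record adaptable (E : separated_graph) := Adaptable {
  adapt_finsep : finitely_separated E;
  adapt_finite : finite_set [set: component E];
  free : set (component E);
  reg : set (component E);
  free_reg_cover : free `|` reg = setT;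
  free_reg_disj : free `&` reg = set0;
  subg : component E -> subgraph E;
  subg_vert : forall p, sub_vert (subg p) = cverts p;
  vtx : component E -> vertex E;
  nsets : component E -> nat;
  nbeta : forall p, 'I_(nsets p) -> nat;
  alpha : forall p, 'I_(nsets p) -> edge E;
  beta : forall p (i : 'I_(nsets p)), 'I_(nbeta i) -> edge E;
  subg_partition : partition setT (fun p => sub_vert (subg p)) setT;
  reg_subg : forall p, reg p ->
    sub_transitive (subg p) /\ sub_row_finite (subg p);
  free_subg : forall p, free p -> sub_vert (subg p) = [set vtx p];
  regP : forall p w, reg p -> sub_vert (subg p) w ->
    [/\ sep w #= `I_1,
        `I_2 #<= sub_out (subg p) w
      & forall e : edge E, src e = w -> sub_edge (subg p) e \/
          exists2 q, clt q p & sub_vert (subg q) (rng e)];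
  free_minimal : forall p, free p ->
    (src @^-1` [set vtx p] = set0 <-> cminimal p);
  free_minimal_nsets : forall p, free p -> cminimal p -> nsets p = 0;
  free_sep : forall p, free p -> ~ cminimal p ->
    let X (i : 'I_(nsets p)) := alpha i |` range (@beta p i) in
    sep (vtx p) = range X /\ injective X;
  free_alpha : forall p, free p -> ~ cminimal p -> forall i : 'I_(nsets p),
    src (alpha i) = vtx p /\ rng (alpha i) = vtx p;
  free_beta : forall p, free p -> ~ cminimal p -> forall i : 'I_(nsets p),
    [/\ 0 < nbeta i, injective (@beta p i)
      & forall t : 'I_(nbeta i), exists2 q, clt q p & sub_vert (subg q) (rng (beta t))];
  free_edge : forall p, free p -> ~ cminimal p ->
    sub_edge (subg p) = range (@alpha p)
}.

(* [GT i v b] is t_(i+1)^v for b = true and its formal inverse for b = false. *)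
Inductive generator (E : digraph) : Type :=
  | GV of vertex E
  | GE of edge E
  | GT of nat & vertex E & bool.

Inductive term (E : digraph) : Type :=
  | TGen of generator E
  | TZero
  | TMul of term E & term E
  | TStar of term E.

Arguments TZero {E}.

Declare Scope sterm_scope.
Delimit Scope sterm_scope with sterm.
Notation "x * y" := (TMul x y) : sterm_scope.
Notation "x ^*" := (TStar x) : sterm_scope.

Definition Tv (E : digraph) (v : vertex E) : term E := TGen (GV v).
Definition Te (E : digraph) (e : edge E) : term E := TGen (GE e).
Definition Tt (E : digraph) (i : nat) (v : vertex E) (b : bool) : term E :=
  TGen (GT i v b).

Local Open Scope sterm_scope.

(* With indices from 0: t_(i+k(p)-1) becomes the index i + (k(p) - 1), and
   sigma_j^p is [unbump j], i.e. i for i < j and i - 1 for i > j. *)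
Inductive defrel (E : separated_graph) (A : adaptable E) :
    term E -> term E -> Prop :=
  | R1_idem (v : vertex E) : defrel A (Tv v * Tv v) (Tv v)
  | R1_orth (v w : vertex E) : v <> w -> defrel A (Tv v * Tv w) TZero
  | R1_star (v : vertex E) : defrel A (Tv v)^* (Tv v)
  | R2_src (e : edge E) : defrel A (Te e) (Tv (src e) * Te e)
  | R2_rng (e : edge E) : defrel A (Te e) (Te e * Tv (rng e))
  | R2_eq (v : vertex E) (X : set (edge E)) (e : edge E) :
      sep v X -> X e -> defrel A ((Te e)^* * Te e) (Tv (rng e))
  | R2_neq (v : vertex E) (X : set (edge E)) (e f : edge E) :
      sep v X -> X e -> X f -> e <> f -> defrel A ((Te e)^* * Te f) TZero
  | R3 p (i j : 'I_(nsets A p)) : free A p -> i <> j ->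
      defrel A (Te (alpha i) * Te (alpha j)) (Te (alpha j) * Te (alpha i))
  | R3_star p (i j : 'I_(nsets A p)) : free A p -> i <> j ->
      defrel A (Te (alpha i) * (Te (alpha j))^*)
               ((Te (alpha j))^* * Te (alpha i))
  | R4 p (i j : 'I_(nsets A p)) (s : 'I_(nbeta i)) (t : 'I_(nbeta j)) :
      free A p -> ~ (i = j /\ s = t :> nat) ->
      defrel A ((Te (beta s))^* * Te (beta t)) TZero
  | R5_comm (v : vertex E) i j a b :
      defrel A (Tt i v a * Tt j v b) (Tt j v b * Tt i v a)
  | R5_unitl (v : vertex E) i : defrel A (Tv v * Tt i v true) (Tt i v true)
  | R5_unitr (v : vertex E) i : defrel A (Tt i v true * Tv v) (Tt i v true)
  | R5_invr (v : vertex E) i :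
      defrel A (Tt i v true * Tt i v false) (Tv v)
  | R5_invl (v : vertex E) i :
      defrel A (Tt i v false * Tt i v true) (Tv v)
  | R5_star (v : vertex E) i : defrel A (Tt i v true)^* (Tt i v false)
  | R6 p (e : edge E) i : reg A p -> sub_vert (subg A p) (src e) ->
      defrel A (Tt i (src e) true * Te e) (Te e * Tt i (rng e) true)
  | R7 p (j : 'I_(nsets A p)) (s : 'I_(nbeta j)) i b : free A p ->
      defrel A (Tt i (vtx A p) b * Te (beta s))
               (Te (beta s) * Tt (i + (nsets A p).-1)%N (rng (beta s)) b)
  | R8 p (i j : 'I_(nsets A p)) (s : 'I_(nbeta j)) : free A p -> i <> j ->
      defrel A (Te (alpha i) * Te (beta s))
               (Te (beta s) * Tt (unbump j i) (rng (beta s)) true)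
  | R8_star p (i j : 'I_(nsets A p)) (s : 'I_(nbeta j)) : free A p -> i <> j ->
      defrel A ((Te (alpha i))^* * Te (beta s))
               (Te (beta s) * Tt (unbump j i) (rng (beta s)) false)
  | R9 p (j : 'I_(nsets A p)) i : free A p ->
      defrel A (Tt i (vtx A p) true * Te (alpha j))
               (Te (alpha j) * Tt i (vtx A p) true)
  | R9_star p (j : 'I_(nsets A p)) i : free A p ->
      defrel A (Tt i (vtx A p) true * (Te (alpha j))^*)
               ((Te (alpha j))^* * Tt i (vtx A p) true).

(* The least congruence on terms that contains the defining relations and whose
   quotient is a *-semigroup with zero. *)
Inductive congr (E : separated_graph) (A : adaptable E) :
    term E -> term E -> Prop :=
  | congr_rel x y : defrel A x y -> congr A x y
  | congr_refl x : congr A x x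
  | congr_sym x y : congr A x y -> congr A y x
  | congr_trans x y z : congr A x y -> congr A y z -> congr A x z
  | congr_mul x x' y y' :
      congr A x x' -> congr A y y' -> congr A (x * y) (x' * y')
  | congr_star x x' : congr A x x' -> congr A x^* x'^*
  | congr_mulA x y z : congr A (x * (y * z)) (x * y * z)
  | congr_starK x : congr A x^*^* x
  | congr_starM x y : congr A (x * y)^* (y^* * x^*)
  | congr_mul0s x : congr A (TZero * x) TZero
  | congr_muls0 x : congr A (x * TZero) TZero.

Local Close Scope sterm_scope.

HB.instance Definition _ (E : digraph) := gen_eqMixin (term E).
HB.instance Definition _ (E : digraph) := gen_choiceMixin (term E).

Section Quotient.
Variables (E : separated_graph) (A : adaptable E).

Definition congrb (x y : term E) : bool := `[< congr A x y >].

Lemma congrb_refl : reflexive congrb.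
Proof. by move=> x; apply/asboolP/congr_refl. Qed.

Lemma congrb_sym : symmetric congrb.
Proof. by move=> x y; apply/asboolP/asboolP => /congr_sym. Qed.

Lemma congrb_trans : transitive congrb.
Proof.
by move=> y x z /asboolP xy /asboolP yz; apply/asboolP/(congr_trans xy yz).
Qed.

Canonical congrb_equiv := EquivRel congrb congrb_refl congrb_sym congrb_trans.

Definition SEC : Type := {eq_quot congrb}.

HB.instance Definition _ := Choice.on SEC.
HB.instance Definition _ := EqQuotient.on SEC.

Lemma SEC_eq (x y : term E) : \pi_SEC x = \pi_SEC y <-> congr A x y.
Proof.
split=> [/eqP|cxy]; first by rewrite piE => /asboolP.
by apply/eqP; rewrite piE; apply/asboolP.
Qed.

Lemma SEC_repr (x : term E) : congr A (repr (\pi_SEC x)) x.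
Proof. by apply/SEC_eq; rewrite reprK. Qed.

Definition SEC_mul := lift_op2 SEC (@TMul E).
Definition SEC_star := lift_op1 SEC (@TStar E).
Definition SEC_zero : SEC := \pi_SEC TZero.

Lemma SEC_pi_mul (x y : term E) :
  SEC_mul (\pi_SEC x) (\pi_SEC y) = \pi_SEC (TMul x y).
Proof.
by rewrite /SEC_mul -lock; apply/SEC_eq/congr_mul; apply: SEC_repr.
Qed.

Lemma SEC_pi_star (x : term E) : SEC_star (\pi_SEC x) = \pi_SEC (TStar x).
Proof. by rewrite /SEC_star -lock; apply/SEC_eq/congr_star/SEC_repr. Qed.

Lemma SEC_mulA : associative SEC_mul.
Proof.
elim/quotW=> x; elim/quotW=> y; elim/quotW=> z; rewrite !SEC_pi_mul.
by apply/SEC_eq; apply: congr_mulA.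
Qed.

HB.instance Definition _ := isSemigroup.Build SEC SEC_mulA.

Lemma SEC_mul0s (x : SEC) : (SEC_zero * x = SEC_zero)%g.
Proof. by elim/quotW: x => x; rewrite [LHS]SEC_pi_mul; apply/SEC_eq/congr_mul0s. Qed.

Lemma SEC_muls0 (x : SEC) : (x * SEC_zero = SEC_zero)%g.
Proof. by elim/quotW: x => x; rewrite [LHS]SEC_pi_mul; apply/SEC_eq/congr_muls0. Qed.

Lemma SEC_starK (x : SEC) : SEC_star (SEC_star x) = x.
Proof. by elim/quotW: x => x; rewrite !SEC_pi_star; apply/SEC_eq/congr_starK. Qed.

Lemma SEC_starM (x y : SEC) :
  (SEC_star (x * y) = SEC_star y * SEC_star x)%g.
Proof.
elim/quotW: x => x; elim/quotW: y => y.
rewrite [(_ * _)%g in LHS]SEC_pi_mul !SEC_pi_star [RHS]SEC_pi_mul.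
by apply/SEC_eq; apply: congr_starM.
Qed.

HB.instance Definition _ := Semigroup_isStar0Semigroup.Build SEC
  SEC_mul0s SEC_muls0 SEC_starK SEC_starM.

End Quotient.

(* Main.v *)
Require Import Defs.
From mathcomp Require Import all_boot.
From mathcomp Require Import boolp classical_sets cardinality.

(* By the relations, the elements of S(E,C) of the form s s^* are products of
   "basic" projections, obtained from 0, the vertices and the projections
   alpha^n (alpha^* )^n at free components by repeatedly applying x |-> c x c^*,
   where c is an edge starting at a regular component or a path alpha^n beta.
   For two such c, d either c^* d = 0 or c = d and c^* d is a vertex, while each
   vertex or alpha^n (alpha^* )^n multiplies such a c to 0 or to c; hence basic
   projections commute. Each generator g satisfies g g^* g = g and conjugates
   products of basic projections to such products, because g c is 0, a vertex,
   or d u with u a vertex or some t_i^v (unless x |-> g x g^* is itself one of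
   the maps above). These properties pass to products, so every s satisfies
   s s^* s = s and all the projections s s^* commute. *)

Set Implicit Arguments.
Unset Strict Implicit.
Unset Printing Implicit Defensive.

Local Open Scope group_scope.

(** * Normalizers of commuting sets in *-semigroups *)

Section StarSemigroup.
Variable S : star0SemigroupType.
Implicit Types (s t x y : S) (B P : set S).

Lemma star0 : star (szero : S) = szero.
Proof. by rewrite -[szero in LHS](muls0 (star szero)) starM starK muls0. Qed.

Definition commuting P : Prop := forall x y, P x -> P y -> commute x y.

Inductive product_of B : S -> Prop :=
  | product_of_gen x : B x -> product_of B x
  | product_of_mul x y : product_of B x ->
      product_of B y -> product_of B (x * y).

Lemma product_of_commuting B : commuting B -> commuting (product_of B).
Proof.
move=> cB x y Px; elim: Px y => {x} [x Bx y|x1 x2 _ IH1 _ IH2 y Py].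
  elim=> {y} [y By|y1 y2 _ c1 _ c2]; first exact: cB.
  exact: commuteM.
by apply/commute_sym/commuteM; apply/commute_sym; [apply: IH1|apply: IH2].
Qed.

(** Partial isometries whose conjugation preserves [P]. Conjugation is taken on one side only, so
    [s] and [star s] are treated separately. *)
Definition normalizer P s : Prop :=
  [/\ s * star s * s = s, P (s * star s)
    & forall x, P x -> P (s * x * star s)].

(** As [star s * s] commutes with [x], s x y s^* = s x s^* s y s^*. So conjugation by [s] is
    multiplicative on products and only has to be checked on [B]. *)
Lemma product_of_normalizer B s : commuting B ->
  s * star s * s = s ->
  product_of B (s * star s) -> product_of B (star s * s) ->
  (forall x, B x -> product_of B (s * x * star s)) ->
  normalizer (product_of B) s.
Proof.
move=> /product_of_commuting cB sss Pss Pss' sB; split=> // x.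
elim=> {x} [x Bx|x y Px IHx Py IHy]; first exact: sB.
suff -> : s * (x * y) * star s = s * x * star s * (s * y * star s).
  exact: product_of_mul.
have /(congr1 (fun z => s * z * y * star s)) := cB _ _ Pss' Px.
by rewrite /= !mulgA sss => ->.
Qed.

(** Commuting t t^* with s^* s turns s t t^* s^* s t into s s^* s t t^* t = s t. *)
Lemma normalizerM P s t : commuting P -> P (star s * s) ->
  normalizer P s -> normalizer P t -> normalizer P (s * t).
Proof.
move=> cP Ps [sss Pss sP] [ttt Ptt tP]; split.
- rewrite starM -[in RHS]sss -[in RHS]ttt.
  have /(congr1 (fun z => s * z * t)) := cP _ _ Ptt Ps.
  by rewrite !mulgA.
- by rewrite starM; have := sP _ Ptt; rewrite !mulgA.
- by move=> x Px; rewrite starM; have := sP _ (tP _ Px); rewrite !mulgA.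
Qed.

(** Existence is s s^* s = s. For uniqueness, idempotents turn out to be self-adjoint, hence lie
    among the commuting projections; for an inverse t of s this applies to s t and t s, and
    comparison with s s^* and s^* s forces t = t s s^* = s^*. *)
Lemma inverse_semigroup_normalizer P : commuting P ->
  (forall s, normalizer P s) ->
  inverse_semigroup S /\ (forall s, semigroup_inverse s (star s)).
Proof.
move=> cP nP.
have sss s : s * star s * s = s by case: (nP s).
have Pss s : P (s * star s) by case: (nP s).
have inv s : semigroup_inverse s (star s).
  by split; rewrite ?sss //; have := sss (star s); rewrite starK.
split=> // s; exists (star s); split=> // t [sts tst].
(* Commuting e^* e with e e^* gives e^* = e^* e e^* = e e^* e = e. *)
have idem_star (e : S) : e * e = e -> star e = e.
  move=> ee; have ee' : star e * star e = star e by rewrite -starM ee.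
  have := cP _ _ (Pss (star e)) (Pss e).
  rewrite /commute starK !mulgA -(mulgA (star e)) ee -[in RHS](mulgA e) ee' sss.
  by have := sss (star e); rewrite starK => ->.
have st : star (s * t) = s * t by apply: idem_star; rewrite mulgA -sts.
have ts : star (t * s) = t * s by apply: idem_star; rewrite mulgA -tst.
have cst : s * t * (s * star s) = s * star s * (s * t).
  have := cP _ _ (Pss (s * t)) (Pss s).
  by rewrite /commute st (mulgA (s * t)) -sts.
have cts : t * s * (star s * s) = star s * s * (t * s).
  have := cP _ _ (Pss (t * s)) (Pss (star s)).
  by rewrite /commute ts starK (mulgA (t * s)) -tst.
(* Multiply the commutation of s t with s s^* by t on the left. *)
have -> : t = t * s * star s.
  move/(congr1 (fun z => t * z)): cst.
  by rewrite !mulgA -tst -(mulgA t s) -(mulgA t) sss -tst => ->.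
have sss' : star s * s * star s = star s by have := sss (star s); rewrite starK.
rewrite -{2}sss' mulgA cts.
by rewrite -(mulgA (star s) s (t * s)) (mulgA s) -sts sss'.
Qed.

End StarSemigroup.

(** * Vertices and edges of adaptable separated graphs *)

Section AdaptableCombinatorics.
Variables (E : separated_graph) (A : adaptable E).
Implicit Types (v w : vertex E) (e f : edge E) (p q : component E).

Lemma component_uniq p q v :
  sub_vert (subg A p) v -> sub_vert (subg A q) v -> p = q.
Proof.
move=> pv qv; have [_ tri _] := subg_partition A.
by apply: tri => //; exists v.
Qed.

Lemma free_reg_excl p : free A p -> reg A p -> False.
Proof.
move=> fp rp; have : (free A `&` reg A)%classic p by [].
by rewrite free_reg_disj.
Qed.

Lemma sub_vert_vtx p : free A p -> sub_vert (subg A p) (vtx A p).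
Proof. by move=> fp; rewrite free_subg. Qed.

Lemma vtx_inj p q : free A p -> free A q -> vtx A p = vtx A q -> p = q.
Proof.
move=> fp fq eqv; apply: (@component_uniq p q (vtx A p)).
  exact: sub_vert_vtx.
by rewrite eqv; exact: sub_vert_vtx.
Qed.

Lemma reg_not_vtx p q v :
  reg A p -> sub_vert (subg A p) v -> free A q -> v <> vtx A q.
Proof.
move=> rp pv fq eqv; apply: (@free_reg_excl q) => //.
by rewrite -(@component_uniq p q v) // eqv; exact: sub_vert_vtx.
Qed.

Lemma vertex_cases v :
  (exists2 p, reg A p & sub_vert (subg A p) v) \/
  (exists2 p, free A p & v = vtx A p).
Proof.
have [cov _ _] := subg_partition A.
have : setT v by []; rewrite -cov => -[p _ pv].
have : setT p by []; rewrite -(free_reg_cover A) => -[fp|rp].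
  2: by left; exists p.
by right; exists p => //; move: pv; rewrite free_subg.
Qed.

Lemma nsets_not_minimal p (i : 'I_(nsets A p)) : free A p -> ~ cminimal p.
Proof.
by move=> fp /(free_minimal_nsets fp) n0; case: i => i; rewrite n0.
Qed.

Lemma sep_src v X e : sep v X -> X e -> src e = v.
Proof.
move=> vX Xe; have [cov _ _] := sepP v.
have : ([set e | src e = v])%classic e; last by [].
by rewrite -[X in X e]cov; exists X.
Qed.

Lemma sep_exists e : exists2 X, sep (src e) X & X e.
Proof.
have [cov _ _] := sepP (src e).
have : (src @^-1` [set src e])%classic e by [].
by rewrite -cov => -[X sX Xe]; exists X.
Qed.

Lemma sep_free p i : free A p ->
  sep (vtx A p) (alpha i |` range (@beta E A p i))%classic.
Proof.
move=> fp; have [-> _] := free_sep fp (nsets_not_minimal i fp).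
by exists i.
Qed.

Lemma src_alpha p (i : 'I_(nsets A p)) : free A p -> src (alpha i) = vtx A p.
Proof. by move=> fp; case: (free_alpha fp (nsets_not_minimal i fp) i). Qed.

Lemma rng_alpha p (i : 'I_(nsets A p)) : free A p -> rng (alpha i) = vtx A p.
Proof. by move=> fp; case: (free_alpha fp (nsets_not_minimal i fp) i). Qed.

Lemma src_beta p (i : 'I_(nsets A p)) (s : 'I_(nbeta i)) :
  free A p -> src (beta s) = vtx A p.
Proof. by move=> fp; apply: (sep_src (sep_free i fp)); right; exists s. Qed.

(** The loop stays in the component p, whereas a beta edge ends in a strictly smaller one. *)
Lemma alpha_neq_beta p (i : 'I_(nsets A p)) (s : 'I_(nbeta i)) :
  free A p -> alpha i <> beta s.
Proof.
move=> fp eqab.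
have [_ _ /(_ s) [q [_ qp]]] := free_beta fp (nsets_not_minimal i fp) i.
rewrite -eqab rng_alpha // => /(component_uniq (sub_vert_vtx fp)).
by move/esym.
Qed.

Lemma edge_cases e :
  [\/ exists2 p, reg A p & sub_vert (subg A p) (src e),
      exists p (i : 'I_(nsets A p)), free A p /\ e = alpha i
    | exists p (i : 'I_(nsets A p)) (s : 'I_(nbeta i)), free A p /\ e = beta s].
Proof.
have [regv|[p fp srcE]] := vertex_cases (src e); first exact: Or31.
(* The edge [e] leaves v^p, so p is not minimal and the explicit partition into alpha and beta edges
   applies. *)
have nmin : ~ cminimal p.
  by move/(free_minimal fp) => src0; have : set0 e by rewrite -src0.
have [X] := sep_exists e; rewrite srcE; have [-> _] := free_sep fp nmin.
move=> [i _ <-] [->|[s _ <-]]; first by apply: Or32; exists p, i.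
by apply: Or33; exists p, i, s.
Qed.

Lemma reg_sep_uniq p v X Y :
  reg A p -> sub_vert (subg A p) v -> sep v X -> sep v Y -> X = Y.
Proof.
move=> rp pv vX vY; have [c1 _ _] := regP rp pv.
have /card_set_bijP [f [fI finj _]] := c1.
apply: (finj X Y); rewrite ?inE //.
by have := fI X vX; have := fI Y vY; rewrite /= !ltnS !leqn0 => /eqP -> /eqP ->.
Qed.

End AdaptableCombinatorics.

(** * The semigroup S(E,C) *)

Section Relations.
Variables (E : separated_graph) (A : adaptable E).
Implicit Types (v w : vertex E) (e f : edge E) (p q : component E).

Local Notation S := (SEC A).
Local Notation cl x := (\pi_(SEC A)%qT x : SEC A).

Definition vtx_elt v : S := cl (Tv v).
Definition edge_elt e : S := cl (Te e).
Definition unit_elt i v b : S := cl (Tt i v b).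

Local Notation V := vtx_elt.
Local Notation Ed := edge_elt.
Local Notation T := unit_elt.

Lemma cl_mul x y : cl (TMul x y) = cl x * cl y.
Proof. by rewrite [RHS]SEC_pi_mul. Qed.

Lemma cl_star x : cl (TStar x) = star (cl x).
Proof. by rewrite [RHS]SEC_pi_star. Qed.

Lemma cl_rel x y : defrel A x y -> cl x = cl y.
Proof. by move=> xy; apply/SEC_eq/congr_rel. Qed.

Lemma vtxE v : V v * V v = V v.
Proof. by rewrite -cl_mul; apply/cl_rel/R1_idem. Qed.

Lemma vtx_orth v w : v <> w -> V v * V w = szero.
Proof. by move=> vw; rewrite -cl_mul (cl_rel (R1_orth A vw)). Qed.

Lemma star_vtx v : star (V v) = V v.
Proof. by rewrite -cl_star; apply/cl_rel/R1_star. Qed.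

Lemma src_edge e : V (src e) * Ed e = Ed e.
Proof. by rewrite -cl_mul; apply/esym/cl_rel/R2_src. Qed.

Lemma edge_rng e : Ed e * V (rng e) = Ed e.
Proof. by rewrite -cl_mul; apply/esym/cl_rel/R2_rng. Qed.

Lemma star_edge_edge e : star (Ed e) * Ed e = V (rng e).
Proof.
have [X sX Xe] := sep_exists e.
by rewrite -cl_star -cl_mul; apply/cl_rel/(R2_eq A sX Xe).
Qed.

Lemma star_edge_orth v X e f :
  sep v X -> X e -> X f -> e <> f -> star (Ed e) * Ed f = szero.
Proof.
move=> sX Xe Xf ef; rewrite -cl_star -cl_mul.
exact/cl_rel/(R2_neq A sX Xe Xf).
Qed.

Lemma star_edge_src e : star (Ed e) * V (src e) = star (Ed e).
Proof. by rewrite -{1}star_vtx -starM src_edge. Qed.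

Lemma vtx_edge_orth v e : v <> src e -> V v * Ed e = szero.
Proof. by move=> ve; rewrite -src_edge mulgA vtx_orth // mul0s. Qed.

Lemma star_edge_src_orth e f : src e <> src f -> star (Ed e) * Ed f = szero.
Proof.
by move=> ef; rewrite -star_edge_src -mulgA vtx_edge_orth // muls0.
Qed.

(** All edges leaving a regular vertex lie in a single set of the partition. *)
Lemma star_reg_edge_orth p e f : reg A p -> sub_vert (subg A p) (src e) ->
  e <> f -> star (Ed e) * Ed f = szero.
Proof.
move=> rp pe ef; have [eqs|/star_edge_src_orth//] := pselect (src e = src f).
have [[X sX Xe] [Y sY Yf]] := (sep_exists e, sep_exists f).
rewrite -eqs in sY; apply: (star_edge_orth sX Xe _ ef).
by rewrite (reg_sep_uniq rp pe sX sY).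
Qed.

Lemma star_unit i v b : star (T i v b) = T i v (~~ b).
Proof.
have starT : star (T i v true) = T i v false.
  by rewrite -cl_star; apply/cl_rel/R5_star.
by case: b; rewrite // -starT starK.
Qed.

Lemma vtx_unit i v b : V v * T i v b = T i v b.
Proof.
case: b; first by rewrite -cl_mul; apply/cl_rel/R5_unitl.
rewrite -[false]/(~~ true) -star_unit -{1}star_vtx -starM; congr star.
by rewrite -cl_mul; apply/cl_rel/R5_unitr.
Qed.

Lemma unit_vtx i v b : T i v b * V v = T i v b.
Proof.
rewrite -{1}[b]negbK -{1}star_unit -star_vtx -starM vtx_unit.
by rewrite star_unit negbK.
Qed.

Lemma unitK i v b : T i v b * T i v (~~ b) = V v.
Proof.
by rewrite -cl_mul; apply: cl_rel; case: b; [apply: R5_invr|apply: R5_invl].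
Qed.

(** Multiplying by the inverse units on both sides transfers a commutation rule from t to its
    inverse, as R6 and R9 are given for t alone. *)
Lemma unit_inv_comm i j v w b x : V v * x = x -> x * V w = x ->
  T i v b * x = x * T j w b -> T i v (~~ b) * x = x * T j w (~~ b).
Proof.
move=> vx xw /(congr1 (fun z => T i v (~~ b) * z * T j w (~~ b))).
rewrite /= !mulgA -(mulgA _ (T j w b)) unitK -(mulgA _ x) xw.
by have := unitK i v (~~ b); rewrite negbK => ->; rewrite vx => ->.
Qed.

Lemma unit_reg_edge p e i b : reg A p -> sub_vert (subg A p) (src e) ->
  T i (src e) b * Ed e = Ed e * T i (rng e) b.
Proof.
move=> rp pe.
have comm_true : T i (src e) true * Ed e = Ed e * T i (rng e) true.
  by rewrite -!cl_mul; apply/cl_rel/(R6 _ rp pe).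
case: b => //; apply: (@unit_inv_comm i i _ _ true) => //.
  exact: src_edge.
exact: edge_rng.
Qed.

(** * Calculus of loops and exits at a free component *)

Section Free.
Variables (p : component E) (fp : free A p).
Implicit Types i j k : 'I_(nsets A p).

Local Notation a i := (Ed (alpha i)).
Local Notation v0 := (V (vtx A p)).
Local Notation b s := (Ed (beta s)).

Lemma vtx_alpha i : v0 * a i = a i.
Proof. by rewrite -(src_alpha i fp) src_edge. Qed.

Lemma alpha_vtx i : a i * v0 = a i.
Proof. by rewrite -(rng_alpha i fp) edge_rng. Qed.

Lemma vtx_star_alpha i : v0 * star (a i) = star (a i).
Proof. by rewrite -{1}star_vtx -starM alpha_vtx. Qed.

Lemma star_alpha_vtx i : star (a i) * v0 = star (a i).
Proof. by rewrite -{1}star_vtx -starM vtx_alpha. Qed.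

Lemma star_alpha_alpha i : star (a i) * a i = v0.
Proof. by rewrite star_edge_edge rng_alpha. Qed.

Lemma vtx_beta i (s : 'I_(nbeta i)) : v0 * b s = b s.
Proof. by rewrite -(src_beta s fp) src_edge. Qed.

Lemma alpha_comm i j : commute (a i) (a j).
Proof.
have [->|ij] := pselect (i = j); first exact: commute_refl.
by rewrite /commute -!cl_mul; apply/cl_rel/R3.
Qed.

Lemma alpha_star_comm i j : i <> j -> commute (a i) (star (a j)).
Proof.
by move=> ij; rewrite /commute -!cl_star -!cl_mul; apply/cl_rel/R3_star.
Qed.

Lemma star_alpha_beta i (s : 'I_(nbeta i)) : star (a i) * b s = szero.
Proof.
apply: (star_edge_orth (sep_free i fp)); first by left.
  by right; exists s.
exact: alpha_neq_beta.
Qed.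

Lemma star_beta_beta i j (s : 'I_(nbeta i)) (t : 'I_(nbeta j)) :
  ~ (i = j /\ s = t :> nat) -> star (b s) * b t = szero.
Proof. by move=> st; rewrite -cl_star -cl_mul; apply/cl_rel/R4. Qed.

Lemma unit_beta i j (s : 'I_(nbeta j)) n c :
  T n (vtx A p) c * b s = b s * T (n + (nsets A p).-1)%N (rng (beta s)) c.
Proof. by rewrite -!cl_mul; apply/cl_rel/R7. Qed.

Lemma alpha_beta i j (s : 'I_(nbeta j)) : i <> j ->
  a i * b s = b s * T (unbump j i) (rng (beta s)) true.
Proof. by move=> ij; rewrite -!cl_mul; apply/cl_rel/R8. Qed.

Lemma star_alpha_beta_neq i j (s : 'I_(nbeta j)) : i <> j ->
  star (a i) * b s = b s * T (unbump j i) (rng (beta s)) false.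
Proof. by move=> ij; rewrite -cl_star -!cl_mul; apply/cl_rel/R8_star. Qed.

Lemma unit_alpha i n c : commute (T n (vtx A p) c) (a i).
Proof.
have comm_true : commute (T n (vtx A p) true) (a i).
  by rewrite /commute -!cl_mul; apply/cl_rel/R9.
case: c => //; apply: (@unit_inv_comm n n _ _ true) => //.
  exact: vtx_alpha.
exact: alpha_vtx.
Qed.

Lemma unit_star_alpha i n c : commute (T n (vtx A p) c) (star (a i)).
Proof.
apply: (can_inj (@starK S)); rewrite !starM starK star_unit.
exact/esym/unit_alpha.
Qed.

(** This is alpha^n times its adjoint, with alpha^0 the vertex; the form of an iterated conjugation
    suits induction on [n]. *)
Definition alpha_proj i n : S := iter n (fun x => a i * x * star (a i)) v0.

Lemma vtx_alpha_proj i n : v0 * alpha_proj i n = alpha_proj i n.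
Proof. by case: n => [|n] /=; rewrite ?vtxE // !mulgA vtx_alpha. Qed.

Lemma alpha_proj_vtx i n : alpha_proj i n * v0 = alpha_proj i n.
Proof. by case: n => [|n] /=; rewrite ?vtxE // -!mulgA star_alpha_vtx. Qed.

Lemma star_alpha_proj i n : star (alpha_proj i n) = alpha_proj i n.
Proof.
by elim: n => [|n IH] /=; rewrite ?star_vtx // !starM starK IH mulgA.
Qed.

Lemma star_alpha_alpha_projS i n :
  star (a i) * alpha_proj i n.+1 = alpha_proj i n * star (a i).
Proof. by rewrite /= !mulgA star_alpha_alpha vtx_alpha_proj. Qed.

Lemma alpha_proj_commute x i n : commute x v0 -> commute x (a i) ->
  commute x (star (a i)) -> commute x (alpha_proj i n).
Proof.
by move=> xv xa xsa; elim: n => //= n IH; do 2?apply: commuteM.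
Qed.

(** For one loop, the inner alpha^* alpha is a vertex, so an outer conjugation by alpha is stripped
    from both factors at once. Distinct loops commute with each other and with each other's adjoints
    by R3. *)
Lemma alpha_proj_comm i j m n : commute (alpha_proj i m) (alpha_proj j n).
Proof.
have projv k l : commute (alpha_proj k l) v0.
  by rewrite /commute alpha_proj_vtx vtx_alpha_proj.
have [->|ij] := pselect (i = j).
  elim: m n => [|m IH] [|n]; try exact: projv.
    exact/commute_sym/projv.
  have projSS (k l : nat) : alpha_proj j k.+1 * alpha_proj j l.+1 =
      a j * (alpha_proj j k * alpha_proj j l) * star (a j).
    rewrite [alpha_proj j k.+1]/= -[in LHS]mulgA star_alpha_alpha_projS.
    by rewrite !mulgA.
  by rewrite /commute projSS IH projSS.
have av k : commute v0 (a k).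
  by rewrite /commute alpha_vtx vtx_alpha.
have sav k : commute v0 (star (a k)).
  by rewrite /commute star_alpha_vtx vtx_star_alpha.
have ji : j <> i by move/esym.
apply: alpha_proj_commute; first exact: projv.
  apply/commute_sym/alpha_proj_commute; first exact/commute_sym/av.
    exact: alpha_comm.
  exact: alpha_star_comm.
apply/commute_sym/alpha_proj_commute; first exact/commute_sym/sav.
  exact/commute_sym/alpha_star_comm.
by rewrite /commute -!starM alpha_comm.
Qed.

Definition beta_path i (s : 'I_(nbeta i)) n : S :=
  iter n (fun x => a i * x) (b s).

Lemma vtx_beta_path i (s : 'I_(nbeta i)) n : v0 * beta_path s n = beta_path s n.
Proof. by case: n => [|n] /=; rewrite ?vtx_beta // mulgA vtx_alpha. Qed.

Lemma beta_path_rng i (s : 'I_(nbeta i)) n :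
  beta_path s n * V (rng (beta s)) = beta_path s n.
Proof. by elim: n => [|n IH] /=; rewrite ?edge_rng // -mulgA IH. Qed.

Lemma star_alpha_beta_path i (s : 'I_(nbeta i)) n :
  star (a i) * beta_path s n.+1 = beta_path s n.
Proof. by rewrite mulgA star_alpha_alpha vtx_beta_path. Qed.

Lemma star_beta_path i (s : 'I_(nbeta i)) n :
  star (beta_path s n) * beta_path s n = V (rng (beta s)).
Proof.
elim: n => [|n IH]; first exact: star_edge_edge.
by rewrite {1}/beta_path iterS starM -mulgA star_alpha_beta_path.
Qed.

(** Extends R7 and R8 from beta to alpha^n beta, with the same unit [y] on the right. *)
Lemma iter_alpha_comm x i (s : 'I_(nbeta i)) n y : commute x (a i) ->
  x * b s = b s * y -> x * beta_path s n = beta_path s n * y.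
Proof.
by move=> xa xb; elim: n => //= n IH; rewrite mulgA xa -mulgA IH mulgA.
Qed.

Lemma alpha_beta_path i j (s : 'I_(nbeta j)) n : i <> j ->
  a i * beta_path s n = beta_path s n * T (unbump j i) (rng (beta s)) true.
Proof.
by move=> ij; apply: iter_alpha_comm; [apply: alpha_comm|apply: alpha_beta].
Qed.

Lemma star_alpha_beta_path_neq i j (s : 'I_(nbeta j)) n : i <> j ->
  star (a i) * beta_path s n =
  beta_path s n * T (unbump j i) (rng (beta s)) false.
Proof.
move=> ij; apply: iter_alpha_comm; last exact: star_alpha_beta_neq.
by apply/commute_sym/alpha_star_comm; move/esym.
Qed.

Lemma unit_beta_path i (s : 'I_(nbeta i)) n m c :
  T m (vtx A p) c * beta_path s n =
  beta_path s n * T (m + (nsets A p).-1)%N (rng (beta s)) c.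
Proof. by apply: iter_alpha_comm; [apply: unit_alpha|apply: unit_beta]. Qed.

(** For i = j the powers of alpha cancel, and if m > n some alpha^* meets beta and gives 0. For
    distinct i and j, alpha and alpha^* pass through the path as a unit and its inverse, which
    cancel. *)
Lemma alpha_proj_beta_path i j (s : 'I_(nbeta j)) m n :
  alpha_proj i m * beta_path s n = szero \/
  alpha_proj i m * beta_path s n = beta_path s n.
Proof.
have projS k l x :
    alpha_proj k l.+1 * x = a k * (alpha_proj k l * (star (a k) * x)).
  by rewrite /= !mulgA.
have [eqij|ij] := pselect (i = j).
  case: j / eqij s => s; elim: m n => [|m IH] n.
    by right; exact: vtx_beta_path.
  rewrite projS; case: n => [|n]; first by left; rewrite star_alpha_beta !muls0.
  rewrite star_alpha_beta_path.
  by have [->|->] := IH n; [left; rewrite muls0|right].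
elim: m => [|m IH]; first by right; exact: vtx_beta_path.
rewrite projS star_alpha_beta_path_neq // (mulgA (alpha_proj i m)).
have [->|->] := IH; first by left; rewrite mul0s muls0.
right; rewrite mulgA alpha_beta_path // -mulgA unitK.
exact: beta_path_rng.
Qed.

(** For distinct i and j the loops leave the middle as units, and R4 kills the remaining beta^*
    beta. For i = j common powers of alpha cancel; a leftover alpha next to beta gives 0, and
    otherwise R4 separates distinct betas. *)
Lemma star_beta_path_orth i j (s : 'I_(nbeta i)) (t : 'I_(nbeta j)) m n :
  star (beta_path s m) * beta_path t n = szero \/
  beta_path s m = beta_path t n.
Proof.
have star_pathS k (u : 'I_(nbeta k)) l :
    star (beta_path u l.+1) = star (beta_path u l) * star (a k).
  by rewrite /= starM.
have [eqij|ij] := pselect (i = j); last first.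
  have ji : j <> i by move/esym.
  left; elim: m => [|m IH]; last first.
    by rewrite star_pathS -mulgA star_alpha_beta_path_neq // mulgA IH mul0s.
  elim: n => [|n IH]; first by apply: star_beta_beta => -[].
  (* The loop stands to the right of beta^*, so R8 is used in adjoint form. *)
  rewrite /= mulgA -[a j]starK -starM star_alpha_beta_neq // starM -mulgA.
  by rewrite IH muls0.
case: j / eqij t => t; elim: m n => [|m IH] [|n].
- have [->|st] := pselect (s = t); first by right.
  by left; apply: star_beta_beta => -[_ /val_inj].
- left; rewrite /= mulgA -[a i]starK -starM star_alpha_beta star0.
  exact: mul0s.
- by left; rewrite star_pathS -mulgA star_alpha_beta muls0.
rewrite star_pathS -mulgA star_alpha_beta_path.
by have [->|eqst] := IH n; [left|right; rewrite /= eqst].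
Qed.

End Free.

(** * Units, connectors and commuting basic projections *)

Inductive is_unit : S -> Prop :=
  | is_unit_vtx v : is_unit (V v)
  | is_unit_elt i v c : is_unit (T i v c).

Inductive connector : S -> Prop :=
  | connector_reg p e : reg A p -> sub_vert (subg A p) (src e) ->
      connector (Ed e)
  | connector_free p (i : 'I_(nsets A p)) (s : 'I_(nbeta i)) n : free A p ->
      connector (beta_path s n).

Inductive diagonal : S -> Prop :=
  | diagonal_vtx v : diagonal (V v)
  | diagonal_alpha p (i : 'I_(nsets A p)) n : free A p ->
      diagonal (alpha_proj i n).

Inductive basic : S -> Prop :=
  | basic_zero : basic szero
  | basic_diagonal x : diagonal x -> basic x
  | basic_conj c x : connector c -> basic x -> basic (c * x * star c).

(** Conjugating c x c^* by [g] amounts to conjugating x by [g * c], so these three outcomes keep the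
    result basic. The middle one occurs when [g] is the adjoint of a connector. *)
Definition shifts (g : S) : Prop := forall c, connector c ->
  [\/ g * c = szero, is_unit (g * c)
    | exists d u, [/\ connector d, is_unit u & g * c = d * u]].

Lemma connector_rng c : connector c ->
  exists2 w, c * V w = c & star c * c = V w.
Proof.
case=> [p e _ _|p i s n fp].
  by exists (rng e); [apply: edge_rng|apply: star_edge_edge].
by exists (rng (beta s)); [apply: beta_path_rng|apply: star_beta_path].
Qed.

Lemma vtx_connector v c : connector c -> V v * c = szero \/ V v * c = c.
Proof.
case=> [p e _ _|p i s n fp].
  have [->|ve] := pselect (v = src e); first by right; exact: src_edge.
  by left; exact: vtx_edge_orth.
have [->|vp] := pselect (v = vtx A p); first by right; exact: vtx_beta_path.
by left; rewrite -vtx_beta_path // mulgA vtx_orth // mul0s.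
Qed.

Lemma star_connector c d : connector c -> connector d ->
  star c * d = szero \/ c = d.
Proof.
have reg_orth p e d' : reg A p -> sub_vert (subg A p) (src e) -> connector d' ->
    star (Ed e) * d' = szero \/ Ed e = d'.
  move=> rp pe [q f _ _|q i s n fq].
    have [->|ef] := pselect (e = f); first by right.
    by left; exact: star_reg_edge_orth rp pe ef.
  left; rewrite -star_edge_src -vtx_beta_path // -mulgA (mulgA (V _)) vtx_orth.
    by rewrite mul0s muls0.
  exact: reg_not_vtx rp pe fq.
case=> [p e rp pe|p i s n fp] cd; first exact: reg_orth rp pe cd.
case: cd (connector_free s n fp) => [q f rq qf|q j t m fq] cc.
  (* The mixed case is the previous one with the two connectors exchanged, read through adjoints. *)
  have [fc|] := reg_orth _ _ _ rq qf cc; last by right.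
  by left; rewrite -[LHS]starK starM starK fc star0.
have [eqpq|pq] := pselect (p = q); last first.
  left; rewrite -(vtx_beta_path fp s) starM star_vtx.
  rewrite -(vtx_beta_path fq t) -mulgA.
  rewrite (mulgA (V _)) vtx_orth ?mul0s ?muls0 //.
  by move/(vtx_inj fp fq).
by case: q / eqpq j t {fq} => j t; exact: star_beta_path_orth.
Qed.

Lemma diagonal_connector x c : diagonal x -> connector c ->
  x * c = szero \/ x * c = c.
Proof.
case=> [v|p i n fp]; first exact: vtx_connector.
have off v y : v <> vtx A p -> V v * y = y -> alpha_proj i n * y = szero.
  move=> vp vy; rewrite -vy -alpha_proj_vtx // -mulgA (mulgA (V _)) vtx_orth.
    by rewrite mul0s muls0.
  by move/esym.
case=> [q e rq qe|q j s m fq].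
  left; apply: (off (src e)); last exact: src_edge.
  exact: reg_not_vtx rq qe fp.
have [eqpq|pq] := pselect (p = q); last first.
  left; apply: (off (vtx A q)); last exact: vtx_beta_path.
  by move/(vtx_inj fq fp)/esym.
by case: q / eqpq j s {fq} => j s; exact: alpha_proj_beta_path.
Qed.

Lemma star_diagonal x : diagonal x -> star x = x.
Proof. by case=> [v|p i n fp]; [apply: star_vtx|apply: star_alpha_proj]. Qed.

Lemma vtx_diagonal v x : diagonal x ->
  (V v * x = szero /\ x * V v = szero) \/ (V v * x = x /\ x * V v = x).
Proof.
case=> [w|p i n fp].
  have [->|vw] := pselect (v = w); first by rewrite vtxE; right.
  by left; split; apply: vtx_orth => // /esym.
have [->|vp] := pselect (v = vtx A p).
  by right; rewrite vtx_alpha_proj // alpha_proj_vtx.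
left; split; first by rewrite -vtx_alpha_proj // mulgA vtx_orth // mul0s.
by rewrite -alpha_proj_vtx // -mulgA vtx_orth ?muls0 // => /esym.
Qed.

Lemma diagonal_comm : commuting diagonal.
Proof.
move=> x y dx dy.
have comm_vtx v z : diagonal z -> commute (V v) z.
  by move=> /(vtx_diagonal v) [] [vz zv]; rewrite /commute vz zv.
case: dx dy => [v|p i n fp] dy; first exact: comm_vtx.
case: dy => [v|q j m fq].
  exact/commute_sym/comm_vtx/diagonal_alpha.
have [eqpq|pq] := pselect (p = q).
  by case: q / eqpq j {fq} => j; exact: alpha_proj_comm.
have pq0 p1 p2 (i1 : 'I_(nsets A p1)) (i2 : 'I_(nsets A p2)) n1 n2 :
    free A p1 -> free A p2 -> p1 <> p2 ->
    alpha_proj i1 n1 * alpha_proj i2 n2 = szero.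
  move=> f1 f2 p12; rewrite -(alpha_proj_vtx f1) -(vtx_alpha_proj f2 i2) -mulgA.
  rewrite (mulgA (V _)) vtx_orth ?mul0s ?muls0 //.
  by move/(vtx_inj f1 f2).
by rewrite /commute !pq0 // => /esym.
Qed.

(** If x c is 0 or c then, since x is self-adjoint, c^* x is correspondingly 0 or c^*, so x acts
    alike on both sides of c y c^*. *)
Lemma diagonal_basic_comm x y : diagonal x -> basic y -> commute x y.
Proof.
move=> dx [|{}y dy|c {}y cc _]; first by rewrite /commute mul0s muls0.
  exact: diagonal_comm.
rewrite /commute !mulgA -[x in RHS]star_diagonal // -[in RHS]mulgA -starM.
by have [->|->] := diagonal_connector dx cc; rewrite // star0 !(mul0s, muls0).
Qed.

(** Different outer connectors make both products 0. For equal ones, c^* c is a vertex commuting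
    with the inner factors, which commute by induction. *)
Lemma basic_comm : commuting basic.
Proof.
move=> x y bx; elim: bx y => {x} [|x dx|c x cc bx IH] y By.
- by rewrite /commute mul0s muls0.
- exact: diagonal_basic_comm.
case: By => [|{}y dy|d {}y cd By]; first by rewrite /commute mul0s muls0.
  exact/commute_sym/diagonal_basic_comm/basic_conj.
have mid (d1 d2 z1 z2 : S) : d1 * z1 * star d1 * (d2 * z2 * star d2) =
    d1 * (z1 * (star d1 * d2) * z2) * star d2 by rewrite !mulgA.
have [cd0|<-] := star_connector cc cd.
  have dc0 : star d * c = szero by rewrite -[LHS]starK starM starK cd0 star0.
  by rewrite /commute !mid cd0 dc0 !(muls0, mul0s).
have [w _ ccw] := connector_rng cc.
rewrite /commute !mid ccw; congr (c * _ * star c).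
have Vy := diagonal_basic_comm (diagonal_vtx w) By.
rewrite -mulgA Vy mulgA (IH _ By) -!mulgA.
by rewrite (diagonal_basic_comm (diagonal_vtx w) bx).
Qed.

Lemma unit_connector u c : is_unit u -> connector c ->
  u * c = szero \/ exists2 u', is_unit u' & u * c = c * u'.
Proof.
case=> [v|m v b] cc.
  have [|->] := vtx_connector v cc; first by left.
  have [w cw _] := connector_rng cc.
  by right; exists (V w); [apply: is_unit_vtx|].
case: cc => [p e rp pe|p i s n fp].
  have [->|ve] := pselect (v = src e).
    right; exists (T m (rng e) b); first exact: is_unit_elt.
    exact: unit_reg_edge rp pe.
  by left; rewrite -unit_vtx -mulgA vtx_edge_orth // muls0.
have [->|vp] := pselect (v = vtx A p).
  right; exists (T (m + (nsets A p).-1)%N (rng (beta s)) b).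
    exact: is_unit_elt.
  exact: unit_beta_path.
left; rewrite -unit_vtx -vtx_beta_path // -mulgA (mulgA (V v)).
by rewrite vtx_orth // mul0s muls0.
Qed.

Lemma star_mul_unit u : is_unit u -> exists2 v, u * star u = V v & u * V v = u.
Proof.
case=> [v|m v b]; exists v; rewrite ?star_vtx ?vtxE //.
  by rewrite star_unit unitK.
exact: unit_vtx.
Qed.

Lemma unit_diagonal u x : is_unit u -> diagonal x ->
  u * x = szero \/ u * x = x * u.
Proof.
move=> uu dx; case: uu => [v|m v b].
  by right; exact: diagonal_comm (diagonal_vtx v) dx.
have [[vx _]|[vx xv]] := vtx_diagonal v dx.
  by left; rewrite -unit_vtx -mulgA vx muls0.
case: dx vx xv => [w|p i n fp] vx xv.
  have [->|/vtx_orth vw] := pselect (v = w).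
    by right; rewrite unit_vtx vtx_unit.
  by left; rewrite -vx vw muls0.
have [->|/vtx_orth vp] := pselect (v = vtx A p).
  right; apply: alpha_proj_commute.
  - by rewrite /commute unit_vtx vtx_unit.
  - exact: unit_alpha.
  - exact: unit_star_alpha.
left; rewrite -unit_vtx -vtx_alpha_proj // -mulgA (mulgA (V v)) vp.
by rewrite mul0s muls0.
Qed.

(** Induction on the basic projection for all units at once, since passing a connector changes the
    index and the vertex of the unit. *)
Lemma basic_unit u x : is_unit u -> basic x -> basic (u * x * star u).
Proof.
move=> uu bx; elim: bx u uu => {x} [|x dx|c x cc bx IH] u uu.
- by rewrite muls0 mul0s; exact: basic_zero.
- have [->|->] := unit_diagonal uu dx.
    by rewrite mul0s; exact: basic_zero.
  have [v uuv _] := star_mul_unit uu; rewrite -mulgA uuv.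
  have [[_ ->]|[_ ->]] := vtx_diagonal v dx; first exact: basic_zero.
  exact: basic_diagonal.
- have -> : u * (c * x * star c) * star u = u * c * x * star (u * c).
    by rewrite starM !mulgA.
  have [->|[u' uu' ->]] := unit_connector uu cc.
    by rewrite !mul0s; exact: basic_zero.
  rewrite starM; have := basic_conj cc (IH u' uu').
  by rewrite !mulgA.
Qed.

Lemma shifts_basic g c x : shifts g -> connector c -> basic x ->
  basic (g * (c * x * star c) * star g).
Proof.
move=> sg cc bx.
have -> : g * (c * x * star c) * star g = g * c * x * star (g * c).
  by rewrite starM !mulgA.
have [->|ugc|[d [u [cd uu ->]]]] := sg c cc.
- by rewrite !mul0s; exact: basic_zero.
- exact: basic_unit.
- rewrite starM; have := basic_conj cd (basic_unit uu bx).
  by rewrite !mulgA.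
Qed.

(** * Generators normalize the products of basic projections *)

Local Notation proj := (product_of basic).

Lemma proj_zero : proj szero.
Proof. exact/product_of_gen/basic_zero. Qed.

Lemma proj_vtx v : proj (V v).
Proof. exact/product_of_gen/basic_diagonal/diagonal_vtx. Qed.

Lemma proj_alpha_proj p (i : 'I_(nsets A p)) n :
  free A p -> proj (alpha_proj i n).
Proof. by move=> fp; exact/product_of_gen/basic_diagonal/diagonal_alpha. Qed.

(** Once [g] shifts connectors, every basic projection of the form c x c^* is settled, which leaves
    the diagonal ones. *)
Lemma shifts_normalizer g : shifts g -> g * star g * g = g ->
  proj (g * star g) -> proj (star g * g) ->
  (forall x, diagonal x -> proj (g * x * star g)) -> normalizer proj g.
Proof.
move=> sg ggg gg' g'g dg; apply: product_of_normalizer => //.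
  exact: basic_comm.
move=> x [|{}x /dg//|c {}x cc bx].
  by rewrite muls0 mul0s; exact: proj_zero.
exact/product_of_gen/shifts_basic.
Qed.

Lemma is_unit_star u : is_unit u -> is_unit (star u).
Proof.
case=> [v|m v b]; first by rewrite star_vtx; exact: is_unit_vtx.
by rewrite star_unit; exact: is_unit_elt.
Qed.

Lemma normalizer_unit u : is_unit u -> normalizer proj u.
Proof.
have proj_uu x : is_unit x -> proj (x * star x).
  by move=> ux; have [v -> _] := star_mul_unit ux; exact: proj_vtx.
move=> uu; apply: shifts_normalizer; last 1 first.
- by move=> x dx; exact/product_of_gen/basic_unit/basic_diagonal.
- move=> c cc; have [->|[u' uu' ->]] := unit_connector uu cc; first exact: Or31.
  by apply: Or33; exists c, u'.
- case: uu => [v|m v b]; first by rewrite star_vtx !vtxE.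
  by rewrite star_unit unitK vtx_unit.
- exact: proj_uu.
- by have := proj_uu _ (is_unit_star uu); rewrite starK.
Qed.

Lemma normalizer_connector c : connector c -> normalizer proj c.
Proof.
move=> cc; have [w cw ccw] := connector_rng cc.
apply: product_of_normalizer; first exact: basic_comm.
- by rewrite -mulgA ccw.
- rewrite -{1}cw; apply/product_of_gen/basic_conj => //.
  exact/basic_diagonal/diagonal_vtx.
- by rewrite ccw; exact: proj_vtx.
- by move=> x bx; exact/product_of_gen/basic_conj.
Qed.

Lemma normalizer_star_connector c : connector c -> normalizer proj (star c).
Proof.
move=> cc; have [w cw ccw] := connector_rng cc.
have [_ cc' _] := normalizer_connector cc.
apply: shifts_normalizer; rewrite ?starK //.
- move=> d cd; have [->|<-] := star_connector cc cd; first exact: Or31.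
  by rewrite ccw; apply/Or32/is_unit_vtx.
- by rewrite ccw -{2}cw starM star_vtx.
- by rewrite ccw; exact: proj_vtx.
(* Since x c is 0 or c, the conjugate c^* x c is 0 or the vertex c^* c. *)
move=> x dx; rewrite -mulgA.
have [->|->] := diagonal_connector dx cc.
  by rewrite muls0; exact: proj_zero.
by rewrite ccw; exact: proj_vtx.
Qed.

(** * Normalizing by a loop at a free component and by its adjoint *)

Section FreeNormalizer.
Variables (p : component E) (fp : free A p) (i : 'I_(nsets A p)).

Local Notation a := (Ed (alpha i)).
Local Notation v0 := (V (vtx A p)).

Lemma shifts_of_free g : g * v0 = g ->
  (forall (j : 'I_(nsets A p)) (s : 'I_(nbeta j)) n, let c := beta_path s n in
     [\/ g * c = szero, is_unit (g * c)
       | exists d u, [/\ connector d, is_unit u & g * c = d * u]]) ->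
  shifts g.
Proof.
move=> gv gb c cc; have [v0c|v0c] := vtx_connector (vtx A p) cc.
  by apply: Or31; rewrite -gv -mulgA v0c muls0.
case: cc v0c => [q e rq qe|q j s n fq] v0c.
  apply: Or31; rewrite -gv -mulgA vtx_edge_orth ?muls0 // => /esym.
  exact: reg_not_vtx rq qe fp.
have [eqpq|pq] := pselect (p = q).
  by case: q / eqpq j s {fq v0c} => j s; exact: gb.
apply: Or31; rewrite -gv -(vtx_beta_path fq s) -mulgA (mulgA v0).
by rewrite vtx_orth ?mul0s ?muls0 // => /(vtx_inj fp fq).
Qed.

Lemma shifts_alpha : shifts a.
Proof.
apply: shifts_of_free => [|j s n c]; first exact: alpha_vtx.
apply: Or33; have [eqij|ij] := pselect (i = j).
  (* The loop belonging to this beta lengthens the path; any other loop becomes a unit on its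
     right. *)
  exists (a * c), (V (rng (beta s))).
  split; last by rewrite -mulgA beta_path_rng.
    by rewrite /c; case: j / eqij s @c => s c; exact: (connector_free s n.+1).
  exact: is_unit_vtx.
exists c, (T (unbump j i) (rng (beta s)) true).
by split; [apply: connector_free|apply: is_unit_elt|apply: alpha_beta_path].
Qed.

Lemma shifts_star_alpha : shifts (star a).
Proof.
apply: shifts_of_free => [|j s n c]; first exact: star_alpha_vtx.
have [eqij|ij] := pselect (i = j); last first.
  apply: Or33; exists c, (T (unbump j i) (rng (beta s)) false).
  split; [exact: connector_free|exact: is_unit_elt|].
  exact: star_alpha_beta_path_neq.
(* The adjoint shortens the path by one loop, or kills it when it is a bare beta. *)
rewrite /c; case: j / eqij s {c} => s; case: n => [|n].
  by apply: Or31; exact: star_alpha_beta.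
apply: Or33; exists (beta_path s n), (V (rng (beta s))).
rewrite star_alpha_beta_path // beta_path_rng.
by split; [apply: connector_free|apply: is_unit_vtx|].
Qed.

Lemma proj_conj_of_free g : g * v0 = g -> proj (g * star g) ->
  (forall (j : 'I_(nsets A p)) n, proj (g * alpha_proj j n * star g)) ->
  forall x, diagonal x -> proj (g * x * star g).
Proof.
move=> gv gg gP x dx; have zero y : v0 * y = szero -> proj (g * y * star g).
  by move=> vy; rewrite -gv -(mulgA g) vy muls0 mul0s; exact: proj_zero.
case: dx => [v|q j n fq].
  have [<-|/vtx_orth vv] := pselect (vtx A p = v); first by rewrite gv.
  exact: zero.
have [eqpq|pq] := pselect (p = q).
  by case: q / eqpq j {fq} => j; exact: gP.
apply: zero; rewrite -(vtx_alpha_proj fq) mulgA vtx_orth ?mul0s //.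
by move/(vtx_inj fp fq).
Qed.

Lemma alpha_star_alpha : a * star a = alpha_proj i 1.
Proof. by rewrite /= alpha_vtx. Qed.

Lemma vtx_comm_alpha : commute v0 a /\ commute v0 (star a).
Proof.
by rewrite /commute vtx_alpha // alpha_vtx // vtx_star_alpha // star_alpha_vtx.
Qed.

Lemma alpha_proj_comm_alpha (j : 'I_(nsets A p)) n : j <> i ->
  commute a (alpha_proj j n) /\ commute (star a) (alpha_proj j n).
Proof.
move=> ji; have ij : i <> j by move/esym.
have [va vsa] := vtx_comm_alpha.
split; apply: alpha_proj_commute.
- exact/commute_sym.
- exact: alpha_comm.
- exact: alpha_star_comm.
- exact/commute_sym.
- exact/commute_sym/alpha_star_comm.
- by rewrite /commute -!starM alpha_comm.
Qed.

Lemma normalizer_alpha : normalizer proj a.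
Proof.
have gg : proj (a * star a) by rewrite alpha_star_alpha; exact: proj_alpha_proj.
apply: shifts_normalizer => //.
- exact: shifts_alpha.
- by rewrite -mulgA star_alpha_alpha // alpha_vtx.
- by rewrite star_alpha_alpha //; exact: proj_vtx.
apply: proj_conj_of_free => // [|j n]; first exact: alpha_vtx.
(* Conjugation by the same loop raises the exponent; a different loop commutes with the
   projection. *)
have [<-|ji] := pselect (i = j); first exact: (proj_alpha_proj i n.+1 fp).
have [ca _] := alpha_proj_comm_alpha n (fun eqji => ji (esym eqji)).
by rewrite ca -mulgA; apply: product_of_mul => //; exact: proj_alpha_proj.
Qed.

Lemma normalizer_star_alpha : normalizer proj (star a).
Proof.
have [_ aa _] := normalizer_alpha.
have gg : proj (star a * a) by rewrite star_alpha_alpha //; exact: proj_vtx.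
apply: shifts_normalizer; rewrite ?starK //.
- exact: shifts_star_alpha.
- by rewrite star_alpha_alpha // vtx_star_alpha.
move=> x dx; rewrite -[X in _ * X](starK a).
apply: proj_conj_of_free dx; rewrite ?starK //; first exact: star_alpha_vtx.
move=> j n; have [<-|ji] := pselect (i = j); last first.
  have [_ ca] := alpha_proj_comm_alpha n (fun eqji => ji (esym eqji)).
  by rewrite ca -mulgA; apply: product_of_mul => //; exact: proj_alpha_proj.
(* Conjugation by the adjoint lowers the exponent; at exponent 0 it gives alpha^* alpha. *)
case: n => [|n]; first by rewrite star_alpha_vtx.
rewrite star_alpha_alpha_projS // -mulgA star_alpha_alpha // alpha_proj_vtx //.
exact: proj_alpha_proj.
Qed.

End FreeNormalizer.

Lemma normalizer_edge e :
  normalizer proj (Ed e) /\ normalizer proj (star (Ed e)).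
Proof.
case: (edge_cases A e) => [[p rp pe]|[p [i [fp ->]]]|[p [i [s [fp ->]]]]].
- have ce := connector_reg rp pe.
  by split; [apply: normalizer_connector|apply: normalizer_star_connector].
- by split; [apply: normalizer_alpha|apply: normalizer_star_alpha].
- have ce := connector_free s 0 fp.
  by split; [apply: normalizer_connector|apply: normalizer_star_connector].
Qed.

(** The adjoint is carried along the induction because a product s t needs s^* s among the
    projections, and this comes from s^* being a normalizer. *)
Lemma normalizer_cl x : normalizer proj (cl x) /\ normalizer proj (star (cl x)).
Proof.
elim: x => [[v|e|n v b]||x [Nx Nx'] y [Ny Ny']|x [Nx Nx']].
- by split; apply: normalizer_unit; rewrite ?star_vtx; exact: is_unit_vtx.
- exact: normalizer_edge.
- by split; apply: normalizer_unit; rewrite ?star_unit; exact: is_unit_elt.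
- suff N0 : normalizer proj (szero : S) by split; rewrite ?star0.
  by split=> [||x _]; rewrite star0 !mul0s //; exact: proj_zero.
- have Nmul (s t : S) : normalizer proj s -> normalizer proj (star s) ->
      normalizer proj t -> normalizer proj (s * t).
    move=> Ns [_ + _] Nt; rewrite starK => Pss.
    exact: normalizerM (product_of_commuting basic_comm) Pss Ns Nt.
  rewrite cl_mul starM.
  by split; apply: Nmul; rewrite ?starK.
- by rewrite cl_star starK.
Qed.

End Relations.

Theorem proposition2p16 (E : separated_graph) (A : adaptable E) :
  inverse_semigroup (SEC A) /\
  (forall s : SEC A, semigroup_inverse s (star s)).
Proof.
apply: inverse_semigroup_normalizer (product_of_commuting (@basic_comm E A)) _.
by elim/quotW=> x; case: (normalizer_cl A x).
Qed.
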